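(* Let $\mathcal A$ be a real Banach space and $\mathcal B=\mathcal A'$ its dual, with weak\* topology $w^*$. Let $\Theta$ be a parameter set, $\theta\mapsto f_\theta\in\mathcal B$ a parametric model, $C:\Theta\to[0,+\infty)$ a parameter cost, $R_\Theta:\mathcal B\to[0,+\infty]$ the parametric representation cost, $R$ its $w^*$-l.s.c. regularization, and $\mathcal F=\{f\in\mathcal B:R(f)<+\infty\}$. Let $\mathsf A:\mathcal B\to\mathbb R^M$ be linear, $G:\mathbb R^M\to[0,+\infty]$, $\lambda>0$, and consider $$L(f):=G(\mathsf Af)+\lambda R(f),\qquad f\in\mathcal B.$$ Suppose that there exists a finite-dimensional subspace $\mathcal N\subset\mathcal B$ such that (i) $R$ is coercive modulo $\mathcal N$, and (ii) $\mathsf A:\mathcal B\to\mathbb R^M$ is $w^*$-continuous and satisfies $\ker(\mathsf A)\cap\mathcal N=\{0\}$. Assume also that $G$ is lower semicontinuous and coercive, and that $L$ is proper. Then there exists $f^\star\in\mathcal F$ such that $$L(f^\star)=\inf_{f\in\mathcal F}L(f).$$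
   Context: $w^*=\sigma(\mathcal B,\mathcal A)$. $\mathcal F_\Theta=\{f_\theta:\theta\in\Theta\}$. $R_\Theta(f)=\inf\{C(\theta):\theta\in\Theta,\ f_\theta=f\}$ for $f\in\mathcal F_\Theta$ and $R_\Theta(f)=+\infty$ for $f\in\mathcal B\setminus\mathcal F_\Theta$. A function $K:\mathcal B\to[-\infty,+\infty]$ is $w^*$-l.s.c. if all sublevel sets $\{K\le\alpha\}$, $\alpha\in\mathbb R$, are $w^*$-closed; its $w^*$-l.s.c. regularization is the largest $w^*$-l.s.c. function bounded above by $K$. $K$ is coercive modulo a subspace $\mathcal N$ if for every $\alpha\in\mathbb R$ there is $\beta>0$ such that $K(f)\le\alpha$ implies $\inf_{g\in\mathcal N}\|f+g\|_{\mathcal B}\le\beta$. $G$ coercive means its sublevel sets are bounded. Proper means finite at some point (and never $-\infty$). *)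

(* Defs.v *)
From HB Require Import structures.
From mathcomp Require Import all_boot all_order all_algebra.
From mathcomp Require Import all_classical all_reals all_analysis.

Set Warnings "-redundant-canonical-projection,-projection-no-head-constant".
Set Implicit Arguments.
Unset Strict Implicit.
Unset Printing Implicit Defensive.

Import Order.TTheory GRing.Theory Num.Theory.
Import numFieldNormedType.Exports.

Local Open Scope classical_set_scope.
Local Open Scope ring_scope.

Section dual_space.
Context {R : realType} {E : normedModType R}.

Definition is_dual : {pred E -> R^o} :=
  fun f => `[< linear f /\ continuous f >].

Lemma is_dual_submod_closed : submod_closed is_dual.
Proof.
split=> [|a f g /asboolP[lf cf] /asboolP[lg cg]]; apply/asboolP; split.
- by move=> a u v /=; rewrite scaler0 addr0.
- exact: cst_continuous.
- move=> b u v; rewrite /= !fctE.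
  rewrite lf lg !scalerDr addrACA; congr (_ + _).
  by congr (_ + _); rewrite !scalerA mulrC.
- by move=> x; apply: cvgD (cg x); apply: cvgZl_tmp (cf x).
Qed.

HB.instance Definition _ :=
  GRing.isSubmodClosed.Build R (E -> R^o) is_dual is_dual_submod_closed.

End dual_space.

Record dual (R : realType) (E : normedModType R) :=
  Dual { dual_fun :> E -> R^o ; _ : is_dual dual_fun }.

Section dual_instances.
Context {R : realType} {E : normedModType R}.

HB.instance Definition _ := [isSub for @dual_fun R E].
HB.instance Definition _ := [Choice of dual E by <:].
HB.instance Definition _ := [SubChoice_isSubLmodule of dual E by <:].

Lemma dual_linear (f : dual E) : linear f.
Proof. by case: f => f /= /asboolP[]. Qed.

Lemma dual_continuous (f : dual E) : continuous f.
Proof. by case: f => f /= /asboolP[]. Qed.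

HB.instance Definition _ (f : dual E) :=
  GRing.isLinear.Build R E R^o *:%R (dual_fun f) (dual_linear f).
HB.instance Definition _ (f : dual E) :=
  @isContinuous.Build E R^o (dual_fun f) (@dual_continuous f).

Lemma dual_eqP (f g : dual E) : (forall x, f x = g x) -> f = g.
Proof. by move=> fg; apply/val_inj/funext. Qed.

Lemma dual0E x : (0 : dual E) x = 0.
Proof. by []. Qed.

Lemma dualDE (f g : dual E) x : (f + g) x = f x + g x.
Proof. by []. Qed.

Lemma dualZE (a : R) (f : dual E) x : (a *: f) x = a * f x.
Proof. by []. Qed.

End dual_instances.

Section dual_norm.
Context {R : realType} {E : normedModType R}.
Implicit Types f g : dual E.

Definition dual_norm f : R := sup [set `|f x| | x in [set x : E | `|x| <= 1]].

Lemma dual_norm_has_sup f :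
  has_sup [set `|f x| | x in [set x : E | `|x| <= 1]].
Proof.
split; first by exists `|f 0|, 0 => //=; rewrite normr0.
have /continuous_linear_bounded/linear_boundedP := @dual_continuous R E f 0.
move=> /pinfty_ex_gt0[r r0 fr]; exists r => _ [x /= x1 <-].
by rewrite (le_trans (fr x))// ler_piMr// ltW.
Qed.

Lemma dual_norm_ub f x : `|x| <= 1 -> `|f x| <= dual_norm f.
Proof. by move=> x1; apply: (sup_upper_bound (dual_norm_has_sup f)); exists x. Qed.

Lemma dual_norm_le f (r : R) :
  (forall x, `|x| <= 1 -> `|f x| <= r) -> dual_norm f <= r.
Proof.
move=> fr; apply: ge_sup; first by case: (dual_norm_has_sup f).
by move=> _ [x /= x1 <-]; exact: fr.
Qed.

Lemma dual_norm_ge0 f : 0 <= dual_norm f.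
Proof. by apply: le_trans (@dual_norm_ub f 0 _); rewrite ?normr0. Qed.

Lemma dual_normD f g : dual_norm (f + g) <= dual_norm f + dual_norm g.
Proof.
apply: dual_norm_le => x x1; rewrite dualDE (le_trans (ler_normD _ _))//.
by rewrite lerD// dual_norm_ub.
Qed.

Lemma dual_normZ (a : R) f : dual_norm (a *: f) = `|a| * dual_norm f.
Proof.
have leZ (b : R) g : dual_norm (b *: g) <= `|b| * dual_norm g.
  apply: dual_norm_le => x x1.
  by rewrite dualZE normrM ler_wpM2l// dual_norm_ub.
apply/eqP; rewrite eq_le leZ /=; have [->|a0] := eqVneq a 0.
  by rewrite normr0 mul0r dual_norm_ge0.
by rewrite -ler_pdivlMl ?normr_gt0// -normfV -{1}(scalerK a0 f) leZ.
Qed.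

Lemma dual_norm_eq0 f : dual_norm f = 0 -> f = 0.
Proof.
move=> f0; apply: dual_eqP => x; rewrite dual0E; apply/eqP.
have [->|x0] := eqVneq x 0; first by rewrite linear0.
have nx0 : `|x| != 0 by rewrite normr_eq0.
have := @dual_norm_ub f (`|x|^-1 *: x).
rewrite normrZ normfV normr_id mulVf// f0 lexx => /(_ isT).
rewrite normr_le0 linearZ /= scaler_eq0 invr_eq0 (negbTE nx0).
by [].
Qed.

HB.instance Definition _ := @Lmodule_isNormed.Build R (dual E)
  dual_norm dual_normD dual_normZ dual_norm_eq0.

End dual_norm.

(* The topology sigma(E', E): the coarsest one for which all evaluations at
   points of E are continuous.  [dual E] itself carries the norm topology. *)
Definition weak_star (R : realType) (E : normedModType R) : Type :=
  initial_topology (fun f : dual E => (dual_fun f : {ptws E -> R^o})).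

HB.instance Definition _ (R : realType) (E : normedModType R) :=
  Topological.on (weak_star E).

Section definitions.
Context {R : realType}.
Local Open Scope ereal_scope.

Definition weak_star_lsc (E : normedModType R) (K : dual E -> \bar R) :=
  forall a : R, closed ([set f | K f <= a%:E] : set (weak_star E)).

Definition lsc_regularization (E : normedModType R) (K : dual E -> \bar R) :
    dual E -> \bar R :=
  fun f => ereal_sup [set H f | H in
    [set H : dual E -> \bar R | weak_star_lsc H /\ forall g, H g <= K g]].

(* The pointwise supremum above is the largest element of its index set. *)
Lemma lsc_regularizationP (E : normedModType R) (K : dual E -> \bar R) :
  [/\ weak_star_lsc (lsc_regularization K),
      forall f, lsc_regularization K f <= K f &
      forall H : dual E -> \bar R, weak_star_lsc H ->
        (forall f, H f <= K f) -> forall f, H f <= lsc_regularization K f].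
Proof.
split=> [a|f|H lH HK f].
- rewrite (_ : [set f | _] = \bigcap_(H in
      [set H : dual E -> \bar R | weak_star_lsc H /\ forall g, H g <= K g])
      ([set f | H f <= a%:E] : set (weak_star E))).
    by apply: closed_bigI => H [lH _]; exact: lH.
  apply/seteqP; split=> [f /= fa H HK|f /= Hf].
    by apply: le_trans fa; apply: ereal_sup_ubound; exists H.
  by apply: ge_ereal_sup => _ [H HK <-]; exact: Hf.
- by apply: ge_ereal_sup => _ [H [_ HK] <-]; exact: HK.
- by apply: ereal_sup_ubound; exists H.
Qed.

(* The infimum of the empty set is +oo, so this is +oo off the model class
   [range f_]. *)
Definition representation_cost (E : normedModType R) (Theta : Type)
    (f_ : Theta -> dual E) (C : Theta -> R) : dual E -> \bar R :=
  fun f => ereal_inf [set (C t)%:E | t in [set t | f_ t = f]].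

Definition finite_dim_subspace (V : lmodType R) (N : set V) : Prop :=
  submod_closed (mem N) /\
  exists (n : nat) (e : 'I_n -> V), (forall i, N (e i)) /\
    forall v, N v -> exists c : 'I_n -> R, v = (\sum_(i < n) c i *: e i)%R.

Definition coercive_modulo (V : normedModType R) (N : set V)
    (K : V -> \bar R) : Prop :=
  forall a : R, exists2 b : R, (0 < b)%R &
    forall f, K f <= a%:E -> (inf [set `|f + g| | g in N] <= b)%R.

Definition coercive (V : normedModType R) (G : V -> \bar R) : Prop :=
  forall a : R, bounded_set [set y | G y <= a%:E].

Definition proper_function (T : Type) (K : T -> \bar R) : Prop :=
  (exists f, K f \is a fin_num) /\ forall f, K f != -oo.

End definitions.

(* Main.v *)
From HB Require Import structures.
Require Import Defs.
From mathcomp Require Import all_boot all_order all_algebra.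
From mathcomp Require Import all_classical all_reals all_analysis.
From mathcomp Require Import lra.
Import Order.TTheory GRing.Theory Num.Theory.
Import numFieldNormedType.Exports.

(* Direct method in the weak-star topology. If L f is bounded by a, coercivity
   of R modulo N gives g in N with f + g in a fixed ball; T is bounded on that
   ball (the weak-star continuous image of a compact set) and T f is bounded by
   coercivity of G, so T g = T (f + g) - T f is bounded, hence so is g because T
   is injective on the finite-dimensional N. Thus the sublevel sets of L lie in
   balls; being weak-star closed, they are weak-star compact by
   Banach-Alaoglu, and L attains its minimum. *)

Local Open Scope classical_set_scope.
Local Open Scope ring_scope.

(** * Minimization and lower semicontinuity *)

Lemma compact_sublevel_argmin {R : realType} {X : topologicalType}
    (K : X -> \bar R) (x0 : X) :
  (forall a : R, closed [set x | (K x <= a%:E)%E]) ->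
  (forall a : R, compact [set x | (K x <= a%:E)%E]) ->
  exists x, forall y, (K x <= K y)%E.
Proof.
move=> Kcl Kco.
have [[a1 Ka1]|Koo] := pselect (exists a : R, exists x, (K x <= a%:E)%E); last first.
  exists x0 => y; suff -> : K y = +oo%E by rewrite leey.
  case Ky : (K y) => [r| |] //; exfalso; apply: Koo.
    by exists r, y; rewrite Ky.
  by exists 0, y; rewrite Ky leNye.
pose D : set R := [set a | exists x, (K x <= a%:E)%E].
pose S (a : R) := [set x | (K x <= a%:E)%E].
(* The nonempty sublevel sets are nested, so they generate a proper filter. A cluster point of it,
   found in a compact one, lies in all of them because they are closed, and hence minimizes [K]. *)
have FF : ProperFilter (filter_from D S).
  apply: filter_from_proper => [|a Da]; last exact: Da.
  apply: filter_from_filter; first by exists a1.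
  move=> a b Da Db; exists (Num.min a b).
    by have [] := leP a b.
  move=> x /=; rewrite /S /= EFin_min le_min => /andP[] //.
have [|x [_ xcl]] := Kco a1 _ FF; first by exists a1.
have Kx a : D a -> (K x <= a%:E)%E.
  move=> Da; have := Kcl a; rewrite closure_id => E.
  suff : [set x | (K x <= a%:E)%E] x by [].
  by rewrite E => B nB; apply: xcl => //; exists a.
exists x => y; case Ky : (K y) => [r| |]; last 2 first.
- by rewrite leey.
(* Here every sublevel set is nonempty, so [K x] is below every real and must be [-oo]. *)
- have Koo (r : R) : (K x <= r%:E)%E by apply: Kx; exists y; rewrite Ky leNye.
  case: (K x) Koo => [r /(_ (r - 1))|/(_ 0)|]//.
  by rewrite lee_fin lerBrDr gerDl ler10.
- by apply: Kx; exists y; rewrite Ky.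
Qed.

(** Links closed sublevel sets, the form used in [weak_star_lsc], to the local form, which is easier
    to add and compose. *)
Lemma lower_semicontinuous_closed {R : realType} {X : topologicalType}
    (K : X -> \bar R) :
  lower_semicontinuous K <-> forall a : R, closed [set x | (K x <= a%:E)%E].
Proof.
rewrite lower_semicontinuousP; split=> H a.
  rewrite -openC (_ : ~` _ = [set x | (a%:E < K x)%E]) //.
  by apply/seteqP; split=> x /=; rewrite ltNge => /negP.
rewrite (_ : [set x | _] = ~` [set x | (K x <= a%:E)%E]); first exact/closed_openC.
by apply/seteqP; split=> x /=; rewrite ltNge => /negP.
Qed.

(** Splits a strict lower bound of a sum into one for each term, so that two neighbourhoods can be
    intersected; [a <= p + q] is enough since [p] and [q] are strict bounds. *)
Lemma lt_adde_split {R : realType} (a : R) (x y : \bar R) :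
  (0 <= x)%E -> (0 <= y)%E -> (a%:E < x + y)%E ->
  exists p q : R, [/\ (p%:E < x)%E, (q%:E < y)%E & a <= p + q].
Proof.
case: x y => [x| |] [y| |] //=; rewrite ?lee_fin => x0 y0.
(* [e] is half the excess of [x + y] over [a]: lowering both terms by [e] leaves exactly [a]. *)
- rewrite -EFinD lte_fin => axy; pose e := (x + y - a) / 2.
  by exists (x - e), (y - e); rewrite !lte_fin /e; split; lra.
- by exists (x - 1), (a - x + 1); rewrite ltry lte_fin; split => //; lra.
- by exists (a - y + 1), (y - 1); rewrite ltry lte_fin; split => //; lra.
- by exists a, 0; rewrite !ltry addr0.
Qed.

Lemma lower_semicontinuousD {R : realType} {X : topologicalType}
    (H K : X -> \bar R) :
  (forall x, (0 <= H x)%E) -> (forall x, (0 <= K x)%E) ->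
  lower_semicontinuous H -> lower_semicontinuous K ->
  lower_semicontinuous (fun x => H x + K x)%E.
Proof.
move=> H0 K0 lH lK x a /lt_adde_split[]// p [q [pH qK apq]].
have [U nU UH] := lH _ _ pH; have [V nV VK] := lK _ _ qK.
exists (U `&` V); first exact: filterI.
move=> y [/UH Hy /VK Ky]; apply: (@le_lt_trans _ _ (p%:E + q%:E)%E).
  by rewrite -EFinD lee_fin.
by apply: lteD.
Qed.

Lemma lower_semicontinuous_comp {R : realType} {X Y : topologicalType}
    (K : Y -> \bar R) (h : X -> Y) :
  continuous h -> lower_semicontinuous K -> lower_semicontinuous (K \o h).
Proof.
move=> ch lK x a /lK[V nV VK]; exists (h @^-1` V) => [|y /VK//].
exact: ch.
Qed.

Lemma lower_semicontinuousZl {R : realType} {X : topologicalType}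
    (K : X -> \bar R) (l : R) :
  0 < l -> lower_semicontinuous K ->
  lower_semicontinuous (fun x => l%:E * K x)%E.
Proof.
move=> l0 lK x a; rewrite -lte_pdivrMl// -EFinM => /lK[V nV VK].
by exists V => // y /VK; rewrite EFinM lte_pdivrMl.
Qed.

(** * Weak-star compactness of balls *)

Lemma ultra_compact_cvg {S : Type} {Y : topologicalType} (F : set_system S)
    (h : S -> Y) (A : set Y) : UltraFilter F -> compact A -> F (h @^-1` A) ->
  exists l : Y, h @ F --> l.
Proof.
move=> FU cA FA; have [|l [_ lcl]] := cA (h @ F) _; first exact: FA.
(* If the preimage of [U] were not in the ultrafilter, that of its complement would be, and the
   cluster point would force [U] to meet its own complement. *)
exists l => U nU; have [//|FC] := in_ultra_setVsetC (h @^-1` U) FU.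
by have [y []] := lcl (~` U) U FC nU.
Qed.

Section dual_ball.
Context {R : realType} {E : normedModType R}.

Lemma dual_le_norm (f : dual E) x : `|f x| <= `|f| * `|x|.
Proof.
have [->|x0] := eqVneq x 0; first by rewrite linear0 !normr0 mulr0.
have nx0 : 0 < `|x| by rewrite normr_gt0.
have := @dual_norm_ub R E f (`|x|^-1 *: x).
rewrite normrZ normfV normr_id mulVf ?gt_eqF// lexx => /(_ isT).
by rewrite linearZ normrM normfV normr_id mulrC ler_pdivrMr.
Qed.

(** Open sets of the initial topology are preimages of open sets of the product topology, where
    convergence is pointwise. *)
Lemma cvg_weak_star (F : set_system (weak_star E)) (f : dual E) : Filter F ->
  (forall x, (fun g : dual E => (g x : R)) @ F --> (f x : R)) ->
  F --> (f : weak_star E).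
Proof.
move=> FF Ff.
have FF' : Filter ((fun g : dual E => (dual_fun g : {ptws E -> R^o})) @ F).
  exact: fmap_filter.
have /pointwise_cvgP Fptws : forall x, (fun g : {ptws E -> R^o} => g x) @
    ((fun g : dual E => (dual_fun g : {ptws E -> R^o})) @ F) --> (f x : R^o).
  exact: Ff.
move=> U; rewrite nbhsE => -[B [[V oV <-] Vf] BU].
apply: (filterS BU); apply: Fptws; exact: open_nbhs_nbhs.
Qed.

(** Along an ultrafilter on the ball each evaluation stays in a compact segment, so it converges.
    The pointwise limit inherits linearity and the bound [r], so it is again in the ball. *)
Lemma banach_alaoglu (r : R) :
  compact ([set f : dual E | `|f| <= r] : set (weak_star E)).
Proof.
rewrite compact_ultra => F FU Fr.
have lim x : exists l : R, (fun f : dual E => f x : R) @ F --> l.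
  apply: (@ultra_compact_cvg _ _ F _ `[- (r * `|x|), r * `|x|]) => //.
    exact: segment_compact.
  apply: filterS Fr => f /= fr; rewrite in_itv /= -ler_norml.
  by rewrite (le_trans (dual_le_norm f x))// ler_wpM2r.
have [g Fg] := choice lim.
have glin : linear (g : E -> R^o).
  move=> a u v; apply: (cvg_unique _ (Fg _)) => //.
  rewrite (_ : (fun f : dual E => _) = (fun f : dual E => a * f u + f v)).
    by apply: cvgD => //; apply: cvgMl_tmp.
  by apply/funext => f; rewrite linearP.
have gr x : `|g x| <= r * `|x|.
  apply: (cvgr_to_le (cvg_norm (Fg x))).
  apply: filterS Fr => f /= fr.
  by rewrite (le_trans (dual_le_norm f x))// ler_wpM2r.
pose G := GRing.isLinear.Build R E R^o *:%R g glin.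
pose g' : {linear E -> R^o} := HB.pack g G.
have gcont : continuous (g : E -> R^o).
  apply: (@bounded_linear_continuous R E R^o g').
  apply/linear_boundedP; near=> s => x.
  rewrite (le_trans (gr x))// ler_wpM2r//; near: s; exact: nbhs_pinfty_ge.
have gd : is_dual (g : E -> R^o) by apply/asboolP; split.
exists (Dual gd); split => /=.
  apply: dual_norm_le => x x1 /=; rewrite (le_trans (gr x))//.
  rewrite ler_piMr//.
  (* [0 <= r] because the ball belongs to [F] and is therefore nonempty. *)
  have [f fr] := filter_ex Fr; exact: le_trans fr.
exact: cvg_weak_star.
Unshelve. all: by end_near. Qed.

End dual_ball.

Lemma mx_norm_entry {R : realType} m n (B : 'M[R]_(m, n)) i j :
  `|B i j| <= `|B|.
Proof.
rewrite [leRHS]mx_normrE.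
by apply: (@le_bigmax _ _ _ 0 (fun ij => `|B ij.1 ij.2|) (i, j)).
Qed.

(** On [N] a left inverse of [T] is given by a matrix, and the entries of that matrix provide
    [k]. *)
Lemma injective_subspace_bound {R : realType} {V : normedModType R} M
    (T : {linear V -> 'rV[R]_M}) (N : set V) :
  finite_dim_subspace N -> [set f | T f = 0] `&` N = [set 0] ->
  exists k : R, forall g, N g -> `|g| <= k * `|T g|.
Proof.
move=> [[N0 NP] [n [e [Ne Nspan]]]] TN.
pose B : 'M[R]_(n, M) := \matrix_i T (e i).
(* [T g *m P] gives coordinates of [g] along the spanning family [e], which
   need not be free. *)
pose P := pinvmx B.
have TS (c : 'I_n -> R) : T (\sum_i c i *: e i) = (\row_i c i) *m B.
  rewrite linear_sum mulmx_sum_row; apply: eq_bigr => i _.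
  by rewrite linearZ rowK mxE.
have Nsum (c : 'I_n -> R) : N (\sum_i c i *: e i).
  suff: \sum_i c i *: e i \in mem N by rewrite inE.
  elim/big_ind : _ => // [u v uN vN|i _].
    by rewrite -[u]scale1r; exact: NP.
  by rewrite -[_ *: _]addr0; apply: NP => //; rewrite inE.
have gE g : N g -> g = \sum_i (T g *m P) 0 i *: e i.
  move=> Ng; apply/eqP; rewrite -subr_eq0; apply/eqP.
  suff : [set 0] (g - \sum_i (T g *m P) 0 i *: e i) by [].
  rewrite -TN; split => /=.
    rewrite linearB TS.
    rewrite (_ : \row_i _ = T g *m P); last by apply/rowP => i; rewrite mxE.
    (* [T g] lies in the row space of [B], so multiplying by [P] and then by [B] gives it back. *)
    have [c ->] := Nspan _ Ng.
    by rewrite TS /P mulmxKpV ?subrr// submxMl.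
  suff: (-1 : R) *: (\sum_i (T g *m P) 0 i *: e i) + g \in mem N.
    by rewrite inE scaleN1r addrC.
  by apply: NP; rewrite inE//; exact: Nsum.
(* The inner sum bounds the [i]-th coordinate of [g] relative to the max norm of [T g]. *)
exists (\sum_i (\sum_j `|P j i|) * `|e i|) => g Ng.
rewrite {1}(gE _ Ng) (le_trans (ler_norm_sum _ _ _))// mulr_suml.
apply: ler_sum => i _; rewrite normrZ mulrAC ler_wpM2r//.
rewrite mxE (le_trans (ler_norm_sum _ _ _))// mulr_suml.
by apply: ler_sum => j _; rewrite normrM mulrC ler_wpM2l// mx_norm_entry.
Qed.

(** * Bounds on costs and sublevel sets *)

Lemma bounded_set_norm_le {R : realType} {V : normedModType R} (S : set V) :
  bounded_set S -> exists k : R, forall y, S y -> `|y| <= k.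
Proof. by move=> /pinfty_ex_gt0[k _ Sk]; exists k. Qed.

(** The zero function competes in the supremum: its sublevel sets are empty or everything, hence
    closed. *)
Lemma lsc_regularization_ge0 {R : realType} {E : normedModType R}
    (K : dual E -> \bar R) :
  (forall f, (0 <= K f)%E) -> forall f, (0 <= lsc_regularization K f)%E.
Proof.
move=> K0; have [_ _] := lsc_regularizationP K; apply => // a.
have [a0|a0] := leP 0 a.
  rewrite (_ : [set _ | _] = setT); first exact: closedT.
  by apply/seteqP; split => //= f _; rewrite lee_fin.
rewrite (_ : [set _ | _] = set0); first exact: closed0.
by apply/seteqP; split => //= f; rewrite lee_fin leNgt a0.
Qed.

Lemma representation_cost_ge0 {R : realType} {E : normedModType R}
    (Theta : Type) (f_ : Theta -> dual E) (C : Theta -> R) :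
  (forall t, 0 <= C t) -> forall f, (0 <= representation_cost f_ C f)%E.
Proof.
by move=> C0 f; apply/ereal_infP => _ [t _ <-]; rewrite lee_fin.
Qed.

Lemma sublevel_norm_le {R : realType} {E : normedModType R} M
    (T : {linear dual E -> 'rV[R]_M}) (N : set (dual E))
    (Reg : dual E -> \bar R) (G : 'rV[R]_M -> \bar R) (a b : R) :
  finite_dim_subspace N -> coercive_modulo N Reg ->
  continuous (T : weak_star E -> 'rV[R]_M) ->
  [set f | T f = 0] `&` N = [set 0] -> coercive G ->
  exists r : R, forall f, (G (T f) <= a%:E)%E -> (Reg f <= b%:E)%E -> `|f| <= r.
Proof.
move=> Nfin RegN Tcont TN Gco.
have [k kN] := injective_subspace_bound M T N Nfin TN.
have [c cG] := bounded_set_norm_le _ (Gco a).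
have [d d0 dReg] := RegN b.
(* The infimum over [N] need not be attained; the radius [d + 1] leaves room for a near-minimizer
   [g]. *)
have [s sT] : exists s : R, forall h : dual E, `|h| <= d + 1 -> `|T h| <= s.
  have := continuous_compact (continuous_subspaceT Tcont)
    (@banach_alaoglu R E (d + 1)).
  move=> /compact_bounded/bounded_set_norm_le[s sT]; exists s => h hd.
  by apply: sT; exists h.
(* The terms bound [f + g] and [g]; the absolute value is there because the sign of [k] is
   unknown. *)
exists (d + 1 + `|k| * (s + c)) => f Gf Rf.
have [_ [g Ng <-] fg] : exists2 t, [set `|f + g| | g in N] t & t < d + 1.
  have [|t Nt tlt] := @inf_adherent R [set `|f + g| | g in N] 1 ltr01.
    split; last by exists 0 => _ [g _ <-].
    case: Nfin => -[N0 _] _; exists `|f + 0|, 0 => //.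
    by move: N0; rewrite inE.
  by exists t => //; rewrite (lt_le_trans tlt)// lerD2r dReg.
have -> : f = (f + g) - g by rewrite addrK.
rewrite (le_trans (ler_normB _ _))// lerD ?(ltW fg)//.
rewrite (le_trans (kN _ Ng))// (le_trans (ler_wpM2r _ (ler_norm k)))//.
rewrite ler_wpM2l//.
have -> : T g = T (f + g) - T f by rewrite linearD addrAC subrr add0r.
by rewrite (le_trans (ler_normB _ _))// lerD ?sT ?(ltW fg) ?cG.
Qed.

(** * Existence of a minimizer *)

Theorem theorem3p16 (R : realType) (A : completeNormedModType R)
  (Theta : Type) (f_ : Theta -> dual A)
  (C : Theta -> R) (C_ge0 : forall t, 0 <= C t)
  (M : nat) (T : {linear dual A -> 'rV[R]_M})
  (G : 'rV[R]_M -> \bar R) (G_ge0 : forall y, (0 <= G y)%E)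
  (lambda : R) (lambda_gt0 : 0 < lambda) :
  let Reg : dual A -> \bar R :=
    lsc_regularization (representation_cost f_ C) in
  let F : set (dual A) := [set f | (Reg f < +oo)%E] in
  let L : dual A -> \bar R := fun f => (G (T f) + lambda%:E * Reg f)%E in
  (exists N : set (dual A),
    [/\ finite_dim_subspace N,
        coercive_modulo N Reg,
        continuous (T : weak_star A -> 'rV[R]_M) &
        [set f | T f = 0] `&` N = [set 0]]) ->
  lower_semicontinuous G ->
  coercive G ->
  proper_function L ->
  exists fstar : dual A, F fstar /\ L fstar = ereal_inf [set L f | f in F].
Proof.
move=> Reg F L [N [Nfin RegN Tcont TN]] lG Gco [[f0 Lf0] _].
have Reg0 f : (0 <= Reg f)%E.
  by apply: lsc_regularization_ge0; exact: representation_cost_ge0.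
have lReg0 f : (0 <= lambda%:E * Reg f)%E by rewrite mule_ge0// lee_fin ltW.
have Lcl (a : R) : closed ([set f | (L f <= a%:E)%E] : set (weak_star A)).
  move: a; apply/(@lower_semicontinuous_closed R (weak_star A)).
  apply: lower_semicontinuousD => //; first exact: lower_semicontinuous_comp.
  apply: lower_semicontinuousZl => //; apply/lower_semicontinuous_closed.
  by have [] := lsc_regularizationP (representation_cost f_ C).
have Lco (a : R) : compact ([set f | (L f <= a%:E)%E] : set (weak_star A)).
  (* Both terms of [L] are nonnegative, so [L f <= a] bounds [G (T f)] by [a] and [Reg f] by
     [a / lambda]. *)
  have [r rL] := sublevel_norm_le M T N Reg G a (a / lambda) Nfin RegN Tcont TN Gco.
  apply: subclosed_compact (@banach_alaoglu R A r) _ => // f /= La.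
  apply: rL; first by rewrite (le_trans _ La)// leeDl.
  rewrite mulrC EFinM lee_pdivlMl//.
  by rewrite (le_trans _ La)// leeDr.
have [fs fsmin] := @compact_sublevel_argmin R (weak_star A) L f0 Lcl Lco.
(* [fs] minimizes over the whole dual; finiteness of [L f0] puts it in [F], so it also realizes the
   infimum over [F]. *)
have Ffs : F fs.
  have Lfs : (L fs < +oo)%E by rewrite (le_lt_trans (fsmin f0))// ltey_eq Lf0.
  rewrite /F /= ltey; apply/eqP => Rfs; move: Lfs.
  by rewrite /L Rfs gt0_muley ?lte_fin// addey// -ltNye (lt_le_trans ltNy0).
exists fs; split => //; apply/eqP; rewrite eq_le; apply/andP; split.
  by apply/ereal_infP => _ [f _ <-]; exact: fsmin.
by apply: ereal_inf_lbound; exists fs.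
Qed.
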